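(* The operator $\mathrm{d}=q\frac{d}{dq}$ maps $\mathcal{MD}$ into itself (hence is a derivation of the $\mathbb{Q}$-algebra $\mathcal{MD}$), and for all $k,l\ge 0$ it maps $\mathrm{Fil}^{W,L}_{k,l}(\mathcal{MD})$ into $\mathrm{Fil}^{W,L}_{k+2,l+1}(\mathcal{MD})$.
   Context: For integers $r_1,\dots,r_l\ge 0$ and $n\ge 1$ let $\sigma_{r_1,\dots,r_l}(n)=\sum v_1^{r_1}\cdots v_l^{r_l}$, summed over all positive integers $u_1>\dots>u_l>0$, $v_1,\dots,v_l>0$ with $u_1v_1+\dots+u_lv_l=n$. For integers $s_1,\dots,s_l\ge1$ the bracket is $[s_1,\dots,s_l]=\frac{1}{(s_1-1)!\cdots(s_l-1)!}\sum_{n>0}\sigma_{s_1-1,\dots,s_l-1}(n)q^n\in\mathbb{Q}[[q]]$, of weight $s_1+\dots+s_l$ and length $l$; $[\emptyset]=1$ has weight and length $0$. $\mathcal{MD}$ is the $\mathbb{Q}$-span of $1$ and all brackets; it is a $\mathbb{Q}$-algebra under multiplication of power series. $\mathrm{Fil}^{W,L}_{k,l}(\mathcal{MD})$ is the $\mathbb{Q}$-span of all brackets (including $1$) of weight $\le k$ and length $\le l$. *)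

(* Defs.v *)
From HB Require Import structures.
From mathcomp Require Import all_boot all_order all_algebra.
From mathcomp Require Import boolp classical_sets.

Set Implicit Arguments.
Unset Strict Implicit.
Unset Printing Implicit Defensive.

Import GRing.Theory.
Local Open Scope ring_scope.

(** * Formal power series *)

(* [Fps a] is the series \sum_(n >= 0) a n * q ^+ n.  A record rather than an
   alias of [nat -> R], so that [*] is the Cauchy product and cannot be
   mistaken for the pointwise product of functions. *)
Record fps (R : Type) := Fps { fps_coef :> nat -> R }.

HB.instance Definition _ (R : Type) := gen_eqMixin (fps R).
HB.instance Definition _ (R : Type) := gen_choiceMixin (fps R).

Lemma fpsP (R : Type) (f g : fps R) : f =1 g -> f = g.
Proof. by case: f g => [f] [g] /= /funext ->. Qed.

Section FpsZmodule.
Variable R : zmodType.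
Implicit Types f g h : fps R.

Definition fps_zero : fps R := Fps (fun=> 0).
Definition fps_opp f : fps R := Fps (fun n => - f n).
Definition fps_add f g : fps R := Fps (fun n => f n + g n).

Lemma fps_addA : associative fps_add.
Proof. by move=> f g h; apply: fpsP => n /=; rewrite addrA. Qed.
Lemma fps_addC : commutative fps_add.
Proof. by move=> f g; apply: fpsP => n /=; rewrite addrC. Qed.
Lemma fps_add0 : left_id fps_zero fps_add.
Proof. by move=> f; apply: fpsP => n /=; rewrite add0r. Qed.
Lemma fps_addN : left_inverse fps_zero fps_opp fps_add.
Proof. by move=> f; apply: fpsP => n /=; rewrite addNr. Qed.

HB.instance Definition _ :=
  GRing.isZmodule.Build (fps R) fps_addA fps_addC fps_add0 fps_addN.

End FpsZmodule.

Section FpsRing.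
Variable R : comNzRingType.
Implicit Types f g h : fps R.

Definition fps_one : fps R := Fps (fun n => (n == 0%N)%:R).
Definition fps_mul f g : fps R :=
  Fps (fun n => \sum_(i < n.+1) f i * g (n - i)%N).

Definition fps_trunc m f : {poly R} := \poly_(i < m.+1) f i.

Lemma coef_fps_trunc m f n : (n <= m)%N -> (fps_trunc m f)`_n = f n.
Proof. by move=> le_nm; rewrite coef_poly ltnS le_nm. Qed.

Lemma coef_fps_mul m f g n : (n <= m)%N ->
  (fps_mul f g) n = (fps_trunc m f * fps_trunc m g)`_n.
Proof.
move=> le_nm; rewrite coefM; apply: eq_bigr => i _.
have le_in : (i <= n)%N by rewrite -ltnS.
by rewrite !coef_fps_trunc ?(leq_trans (leq_subr _ _)) // (leq_trans le_in).
Qed.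

Lemma fps_mulC : commutative fps_mul.
Proof.
by move=> f g; apply: fpsP => n; rewrite !(coef_fps_mul _ _ (leqnn n)) mulrC.
Qed.

Lemma fps_mulA : associative fps_mul.
Proof.
suff half f g h n : (fps_mul (fps_mul f g) h) n =
    (fps_trunc n f * fps_trunc n g * fps_trunc n h)`_n.
  move=> f g h; apply: fpsP => n.
  by rewrite half fps_mulC half mulrC mulrA.
rewrite coefM; apply: eq_bigr => i _.
have le_in : (i <= n)%N by rewrite -ltnS.
by rewrite (coef_fps_mul f g le_in) coef_fps_trunc ?leq_subr.
Qed.

Lemma fps_mul1 : left_id fps_one fps_mul.
Proof.
move=> f; apply: fpsP => n /=; rewrite big_ord_recl big1 /=.
  by rewrite mul1r addr0 subn0.
by move=> i _; rewrite mul0r.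
Qed.

Lemma fps_mulDl : left_distributive fps_mul (@fps_add R).
Proof.
move=> f g h; apply: fpsP => n /=; rewrite -big_split /=.
by apply: eq_bigr => i _; rewrite mulrDl.
Qed.

Lemma fps_one_neq0 : fps_one != 0.
Proof.
apply/eqP => /(congr1 (fun f : fps R => f 0%N)) /= /eqP.
by rewrite oner_eq0.
Qed.

HB.instance Definition _ := GRing.Zmodule_isComNzRing.Build (fps R)
  fps_mulA fps_mulC fps_mul1 fps_mulDl fps_one_neq0.

Definition fps_scale (a : R) f : fps R := Fps (fun n => a * f n).

Lemma fps_scaleA a b f : fps_scale a (fps_scale b f) = fps_scale (a * b) f.
Proof. by apply: fpsP => n /=; rewrite mulrA. Qed.
Lemma fps_scale1 : left_id 1 fps_scale.
Proof. by move=> f; apply: fpsP => n /=; rewrite mul1r. Qed.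
Lemma fps_scaleDr : right_distributive fps_scale +%R.
Proof. by move=> a f g; apply: fpsP => n /=; rewrite mulrDr. Qed.
Lemma fps_scaleDl f : {morph fps_scale^~ f : a b / a + b}.
Proof. by move=> a b; apply: fpsP => n /=; rewrite mulrDl. Qed.

HB.instance Definition _ := GRing.Zmodule_isLmodule.Build R (fps R)
  fps_scaleA fps_scale1 fps_scaleDr fps_scaleDl.

Lemma fps_scaleAl (a : R) f g : a *: (f * g) = (a *: f) * g.
Proof.
apply: fpsP => n /=; rewrite mulr_sumr.
by apply: eq_bigr => i _; rewrite mulrA.
Qed.

HB.instance Definition _ :=
  GRing.Lmodule_isLalgebra.Build R (fps R) fps_scaleAl.
HB.instance Definition _ := GRing.Lalgebra_isComAlgebra.Build R (fps R).

(* The formal variable q. *)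
Definition fpsq : fps R := Fps (fun n => (n == 1%N)%:R).

(* The formal derivative d/dq. *)
Definition fps_deriv f : fps R := Fps (fun n => f n.+1 *+ n.+1).

(* The operator q * d/dq. *)
Definition qderiv f : fps R := fpsq * fps_deriv f.

Lemma qderivE f n : qderiv f n = f n *+ n.
Proof.
rewrite /qderiv /=; case: n => [|n].
  by rewrite big_ord1 mul0r.
rewrite big_ord_recl mul0r add0r big_ord_recl /= mul1r subSS subn0.
by rewrite big1 ?addr0 // => i _; rewrite mul0r.
Qed.

End FpsRing.

Arguments fpsq {R}.

(** * Spans and derivations *)

Definition linear_span (K : nzRingType) (V : lmodType K) (S : set V) : set V :=
  fun x => exists (n : nat) (c : 'I_n -> K) (v : 'I_n -> V),
    (forall i, S (v i)) /\ x = \sum_i c i *: v i.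

(* [D] restricts to a derivation of [B], meant for [B] a subalgebra. *)
Definition derivation_of (K : nzRingType) (A : algType K) (B : set A)
    (D : A -> A) : Prop :=
  [/\ forall f, B f -> B (D f),
      forall (a : K) f g, B f -> B g -> D (a *: f + g) = a *: D f + D g
    & forall f g, B f -> B g -> D (f * g) = D f * g + f * D g].

(** * Brackets *)

(* For r = [:: r_1; ...; r_l], the sum runs over the pairs uv of l-tuples
   u = uv.1 and v = uv.2 (indexed from 0).  Bounding their entries by n is
   harmless: all of them are positive and u_1 v_1 + ... + u_l v_l = n. *)
Definition sigma (r : seq nat) (n : nat) : nat :=
  (\sum_(uv : {ffun 'I_(size r) -> 'I_n.+1} * {ffun 'I_(size r) -> 'I_n.+1} |
       [&& [forall i, 0 < uv.1 i],
           [forall i : 'I_(size r), forall j : 'I_(size r),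
              (i < j) ==> (uv.1 j < uv.1 i)],
           [forall i, 0 < uv.2 i]
         & \sum_(i < size r) uv.1 i * uv.2 i == n])
     \prod_(i < size r) uv.2 i ^ nth 0 r i)%N.

(* Only meaningful when all entries of s are positive. *)
Definition bracket (s : seq nat) : fps rat :=
  if s is [::] then 1 else
  ((\prod_(k <- s) (k.-1)`!)%N%:R)^-1 *:
    Fps (fun n => if n == 0%N then 0 else (sigma [seq k.-1 | k <- s] n)%:R).

Definition weight (s : seq nat) : nat := sumn s.

(* The length is [size s]; the case s = [::] contributes the series 1. *)
Definition MD : set (fps rat) :=
  linear_span (fun f => exists s : seq nat,
    all (leq 1) s /\ f = bracket s).

Definition FilWL (k l : nat) : set (fps rat) :=
  linear_span (fun f => exists s : seq nat,
    [/\ all (leq 1) s, (weight s <= k)%N, (size s <= l)%N & f = bracket s]).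

(* Main.v *)
Require Import Defs.
From mathcomp Require Import all_boot all_order all_algebra.
From mathcomp Require Import zify ring.

(** The proof evaluates the product [2] * [s_1, ..., s_l] in two ways.  Encode
    the index (u, v) of a bracket as the Young diagram with corners
    (x_i, y_i) = (v_i, u_i - u_(i+1)), so that conjugation of partitions
    reverses the sequence and swaps x and y.  Multiplying by
    [2] = \sum_(a, b) a * q ^ (a * b) inserts an a x b rectangle into the
    diagram.  Inserted according to b, it contributes brackets of weight at most
    k + 2 and length at most l + 1, with coefficients that are polynomial in the
    v_i by Faulhaber's formula.  Inserted according to a, it contributes further
    such brackets, except when a equals some w_j = v_1 + ... + v_j: there are
    y_j - 1 choices of b, and \sum_j w_j * (y_j - 1) = n - \sum_j w_j is the
    eigenvalue of q d/dq up to a polynomial in the v_i.  Comparing the two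
    expansions expresses q d/dq [s_1, ..., s_l] through brackets. *)

Set Implicit Arguments.
Unset Strict Implicit.
Unset Printing Implicit Defensive.

Import GRing.Theory.
Local Open Scope ring_scope.

(** * Diagrams and insertion of a rectangle *)

Definition pos_cell := [pred p : nat * nat | (0 < p.1)%N && (0 < p.2)%N].

(* With [t = [:: (x_1, y_1); ...; (x_l, y_l)]], [v_i = x_i] and
   [u_i = y_i + ... + y_l], this is [u_1 * v_1 + ... + u_l * v_l]. *)
Fixpoint area (t : seq (nat * nat)) : nat :=
  if t is p :: t' then (p.1 * (p.2 + sumn (unzip2 t')) + area t')%N else 0%N.

(** When a corner is removed, its width passes to the next corner, which keeps the later prefix sums
    unchanged. A removed last corner has no successor, so the empty diagram stays empty. *)
Definition widen (x : nat) (t : seq (nat * nat)) : seq (nat * nat) :=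
  if t is p :: t' then ((x + p.1)%N, p.2) :: t' else [::].

Definition prepend (p : nat * nat) (q : (nat * nat) * seq (nat * nat)) :=
  (((p.1 + q.1.1)%N, q.1.2), p :: q.2).

(* All ways to see [t] as the result of inserting a rectangle [(a, b)] into a
   diagram [s], as pairs [((a, b), s)]: in [removals], [a] is none of the
   prefix sums of the x-coordinates of [s]; in [splittings], it is one. *)
Fixpoint removals (t : seq (nat * nat)) : seq ((nat * nat) * seq (nat * nat)) :=
  if t is p :: t' then (p, widen p.1 t') :: map (prepend p) (removals t')
  else [::].

Fixpoint splittings (t : seq (nat * nat)) :
    seq ((nat * nat) * seq (nat * nat)) :=
  if t is p :: t' then
    [seq ((p.1, b), (p.1, (p.2 - b)%N) :: t') | b <- index_iota 1 p.2]
      ++ map (prepend p) (splittings t')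
  else [::].

(** The sum of the y-coordinates is carried along in the induction because [area] multiplies each
    x-coordinate by such a sum. *)
Lemma removals_area t q : q \in removals t ->
  (q.1.2 + sumn (unzip2 q.2) = sumn (unzip2 t))%N /\
  (q.1.1 * q.1.2 + area q.2 = area t)%N.
Proof.
elim: t q => [|[x y] t IH] q //=; rewrite inE => /orP[/eqP->|/mapP[q' + ->]].
  by case: t {IH} => [|[x' y'] t] /=; split; rewrite ?mulnDl; lia.
by move=> /IH /=; case: q' => [[a b] s] /= [E1 E2]; split; nia.
Qed.

Lemma splittings_area t q : q \in splittings t ->
  (q.1.2 + sumn (unzip2 q.2) = sumn (unzip2 t))%N /\
  (q.1.1 * q.1.2 + area q.2 = area t)%N.
Proof.
elim: t q => [|[x y] t IH] q //=.
rewrite mem_cat => /orP[/mapP[b + ->]|/mapP[q' + ->]].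
  by rewrite mem_index_iota /=; split; nia.
by move=> /IH /=; case: q' => [[a b] s] /= [E1 E2]; split; nia.
Qed.

Lemma unzip1_splittings t q : q \in splittings t -> unzip1 q.2 = unzip1 t.
Proof.
elim: t q => [|[x y] t IH] q //=.
rewrite mem_cat => /orP[/mapP[b _ ->]//|/mapP[q' /IH E ->]] /=.
by rewrite E.
Qed.

Lemma area_ge t : all pos_cell t ->
  (sumn (unzip1 t) <= area t)%N /\ (sumn (unzip2 t) <= area t)%N.
Proof.
elim: t => [|[x y] t IH] //= /andP[/andP[x0 y0] /IH[]] *; split; nia.
Qed.

(** * Finite ranges of diagrams and the insertion bijection *)

Definition cells (K : nat) : seq (nat * nat) :=
  [seq (x, y) | x <- index_iota 1 K.+1, y <- index_iota 1 K.+1].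

(** All diagrams with [l] corners and coordinates between 1 and [K]. The cutoff makes the sums
    finite; with [K = n] no diagram of area [n] is lost. *)
Fixpoint box (K l : nat) : seq (seq (nat * nat)) :=
  if l is l'.+1 then [seq p :: t | p <- cells K, t <- box K l']
  else [:: [::]].

Lemma mem_cells K p :
  (p \in cells K) = (1 <= p.1 <= K)%N && (1 <= p.2 <= K)%N.
Proof.
apply/allpairsP/idP => [[[x y]] /= [+ + ->] /=|].
  by rewrite !mem_index_iota !ltnS => -> ->.
by case: p => x y /andP[hx hy]; exists (x, y); rewrite !mem_index_iota.
Qed.

Lemma mem_box K l t :
  (t \in box K l) = (size t == l) && all (mem (cells K)) t.
Proof.
elim: l t => [|l IH] [|p t] //=.
  by apply/negbTE/allpairsP => -[[p t] /= []].
rewrite eqSS; apply/allpairsP/idP => [[[p' t'] /= [hp ht [-> ->]]]|].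
  by rewrite hp andTb -IH.
case/and3P=> ht hp ha; exists (p, t); split=> //=.
by rewrite IH ht.
Qed.

Lemma mem_box_pos K l t : t \in box K l -> size t = l /\ all pos_cell t.
Proof.
rewrite mem_box => /andP[/eqP-> /allP ht]; split=> //; apply/allP => p /ht.
by rewrite /= mem_cells => /andP[/andP[-> _] /andP[->]].
Qed.

Lemma uniq_cells K : uniq (cells K).
Proof. by apply: allpairs_uniq => [||[? ?] [? ?] _ _ //]; apply: iota_uniq. Qed.

Lemma uniq_box K l : uniq (box K l).
Proof.
elim: l => [|l IH] //=; apply: allpairs_uniq => //; first exact: uniq_cells.
by move=> [? ?] [? ?] _ _ [-> ->].
Qed.

Arguments box K l : simpl never.

Section Insertion.
Variables (V : zmodType) (K : nat).

Lemma sum_shift (a : nat) (g : nat -> V) : (forall x, (K < x)%N -> g x = 0) ->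
  \sum_(1 <= x < K.+1 | (a < x)%N) g x = \sum_(1 <= x < K.+1) g (a + x)%N.
Proof.
move=> g0; have [leKa|ltaK] := leqP K a.
  rewrite big_nat_cond big_pred0 => [|x]; last by lia.
  (* If [K <= a], the left range is empty and every argument on the right exceeds [K]. *)
  by rewrite big_nat big1 // => x hx; apply: g0; lia.
rewrite (@big_cat_nat _ _ _ a.+1) //=; last by lia.
rewrite big_nat_cond big_pred0 ?add0r => [|x]; last by lia.
rewrite [RHS](@big_cat_nat _ _ _ (K - a).+1) //=; last by lia.
rewrite [X in _ = _ + X]big_nat [X in _ = _ + X]big1 ?addr0 => [|x hx]; last first.
  by apply: g0; lia.
rewrite big_nat_cond (eq_bigl (fun x => (a < x < K.+1)%N)) => [|x]; last by lia.
rewrite -big_nat -[in LHS](add1n a) big_addn subSn; last by lia.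
by apply: eq_bigr => x _; rewrite addnC.
Qed.

Lemma sum_cells (F : nat * nat -> V) :
  \sum_(p <- cells K) F p =
  \sum_(1 <= x < K.+1) \sum_(1 <= y < K.+1) F (x, y).
Proof. by rewrite big_allpairs. Qed.

Lemma sum_boxS l (F : seq (nat * nat) -> V) :
  \sum_(t <- box K l.+1) F t =
  \sum_(p <- cells K) \sum_(t <- box K l) F (p :: t).
Proof. by rewrite [LHS]big_allpairs_dep. Qed.

(** Trichotomy for the rectangle width [p.1] against the width [z.1] of the first corner. The three
    sums are the cases smaller, equal and larger, with the difference of the widths as new variable.
    In the equal case the combined height is the new variable. *)
Lemma sum_cells_compare (G : nat * nat -> nat * nat -> V) :
  (forall p z, pos_cell p -> pos_cell z ->
     [|| K < p.1, K < z.1 | K < p.2 + z.2]%N -> G p z = 0) ->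
  \sum_(p <- cells K) \sum_(z <- cells K) G p z =
    \sum_(p <- cells K) \sum_(z <- cells K) G p ((p.1 + z.1)%N, z.2)
  + \sum_(z <- cells K) \sum_(1 <= b < z.2) G (z.1, b) (z.1, (z.2 - b)%N)
  + \sum_(z <- cells K) \sum_(p <- cells K) G ((z.1 + p.1)%N, p.2) z.
Proof.
move=> G0; pose I := index_iota 1 K.+1.
have memI x : x \in I -> (0 < x <= K)%N by rewrite mem_index_iota ltnS.
pose H a x := \sum_(b <- I) \sum_(y <- I) G (a, b) (x, y).
have sumH : \sum_(p <- cells K) \sum_(z <- cells K) G p z =
    \sum_(a <- I) \sum_(x <- I) H a x.
  rewrite sum_cells; apply: eq_bigr => a _; rewrite [RHS]exchange_big /=.
  by apply: eq_bigr => b _; rewrite sum_cells.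
have split3 a : a \in I -> \sum_(x <- I) H a x =
    \sum_(x <- I | (a < x)%N) H a x + H a a + \sum_(x <- I | (x < a)%N) H a x.
  move=> Ia; rewrite (bigD1_seq a) ?iota_uniq //=.
  rewrite (bigID (fun x => a < x)%N) /= addrCA addrA.
  by congr (_ + _ + _); apply: eq_bigl => x; lia.
rewrite sumH big_seq (eq_bigr _ split3) -big_seq !big_split /=.
congr (_ + _ + _).
- rewrite sum_cells !big_seq; apply: eq_bigr => a /memI ha.
  rewrite sum_shift => [|x hx]; last first.
    by rewrite /H !big_seq big1 // => b /memI hb; rewrite big_seq big1 // => y /memI hy;
       apply: G0 => /=; lia.
  rewrite exchange_big /=; apply: eq_bigr => b _.
  by rewrite sum_cells.
- rewrite sum_cells !big_seq; apply: eq_bigr => a /memI ha.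
  (* The total height b + y becomes the summation variable; the hypothesis on [p.2 + z.2] discards
     totals beyond [K]. *)
  transitivity (\sum_(b <- I) \sum_(y <- I | (b < y)%N) G (a, b) (a, (y - b)%N)).
    rewrite /H !big_seq; apply: eq_bigr => b /memI hb.
    rewrite (@sum_shift b (fun y => G (a, b) (a, (y - b)%N))) => [|y hy].
      by apply: eq_bigr => y _; rewrite addKn.
    by apply: G0 => /=; lia.
  rewrite (exchange_big_dep xpredT) //= !big_seq.
  apply: eq_bigr => y /memI hy /=.
  rewrite (@big_nat_widen _ _ _ 1 y K.+1) //; lia.
- rewrite sum_cells (exchange_big_dep xpredT) //= !big_seq.
  apply: eq_bigr => x /memI hx.
  rewrite sum_shift => [|a ha]; last first.
    rewrite /H !big_seq big1 // => b /memI hb; rewrite big_seq big1 // => y /memI hy.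
    by apply: G0 => /=; lia.
  rewrite [RHS]exchange_big sum_cells.
  by apply: eq_bigr => a _; apply: eq_bigr => b _.
Qed.

(** Each pair of a rectangle and a diagram arises exactly once: as a removal if the insertion
    creates a new corner, as a splitting if it only raises an existing one. The induction compares
    the rectangle with the first corner; the vanishing hypothesis absorbs the cutoff. *)
Lemma sum_insertion l (F : nat * nat -> seq (nat * nat) -> V) :
  (forall p t, pos_cell p -> all pos_cell t ->
     [|| K < p.1, K < sumn (unzip1 t) | K < p.2 + sumn (unzip2 t)]%N ->
     F p t = 0) ->
  \sum_(p <- cells K) \sum_(t <- box K l) F p t =
    \sum_(t <- box K l.+1) \sum_(q <- removals t) F q.1 q.2
  + \sum_(t <- box K l) \sum_(q <- splittings t) F q.1 q.2.
Proof.
elim: l F => [|l IH] F F0.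
  rewrite sum_boxS big_seq1 big_nil addr0.
  by apply: eq_bigr => p _; rewrite !big_seq1.
transitivity (\sum_(p <- cells K) \sum_(z <- cells K)
                \sum_(t <- box K l) F p (z :: t)).
  by apply: eq_bigr => p _; rewrite sum_boxS.
rewrite sum_cells_compare => [|p z hp hz hK]; last first.
  rewrite big_seq big1 // => t /mem_box_pos[_ ht].
  by apply: F0 => //; [apply/andP | move: hK => /=; lia].
(* A rectangle wider than the first corner [z] is inserted into the tail, with [z] kept in front and
   its width subtracted. *)
have step z : z \in cells K ->
    \sum_(p <- cells K) \sum_(t <- box K l) F ((z.1 + p.1)%N, p.2) (z :: t) =
      \sum_(t <- box K l.+1) \sum_(q <- map (prepend z) (removals t)) F q.1 q.2
    + \sum_(t <- box K l) \sum_(q <- map (prepend z) (splittings t)) F q.1 q.2.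
  rewrite mem_cells => hz.
  rewrite (IH (fun p t => F ((z.1 + p.1)%N, p.2) (z :: t))) => [|p t hp ht hK].
    by congr (_ + _); apply: eq_bigr => t _; rewrite big_map.
  apply: F0 => //=; first by move: hp => /=; lia.
    by rewrite ht andbT; case/and3P: hz => /andP[-> _] ->.
  by move: hK => /=; lia.
rewrite [X in _ + _ + X]big_seq (eq_bigr _ step) -big_seq big_split /=.
(* The narrow case supplies the removal of the head corner and the equal case its splittings; the
   wide case supplies everything under [prepend]. *)
rewrite -addrA [X in _ + X]addrCA addrA; congr (_ + _).
  rewrite sum_boxS -big_split /=; apply: eq_bigr => p _.
  rewrite !sum_boxS -big_split /=; apply: eq_bigr => z _.
  rewrite -big_split /=; apply: eq_bigr => t _.
  by rewrite [RHS]big_cons.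
rewrite sum_boxS -big_split /=; apply: eq_bigr => z _.
rewrite exchange_big /= -big_split /=; apply: eq_bigr => t _.
by rewrite [RHS]big_cat /=; congr (_ + _); rewrite big_map.
Qed.

End Insertion.

(** Insertion adds areas, and every coordinate sum is bounded by the total area [n], so the cutoff
    [K = n] is harmless. *)
Lemma sum_insertion_area (V : zmodType) n l
    (F : nat * nat -> seq (nat * nat) -> V) :
  \sum_(p <- cells n) \sum_(t <- box n l | (p.1 * p.2 + area t == n)%N) F p t =
    \sum_(t <- box n l.+1 | area t == n) \sum_(q <- removals t) F q.1 q.2
  + \sum_(t <- box n l | area t == n) \sum_(q <- splittings t) F q.1 q.2.
Proof.
under eq_bigr do rewrite big_mkcond /=.
rewrite sum_insertion => [|p t /andP[p1 p2] ht hK]; last first.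
  case: eqP => // E; have [h1 h2] := area_ge ht.
  by case/or3P: hK => hK; exfalso; nia.
congr (_ + _); rewrite [RHS]big_mkcond; apply: eq_bigr => t _;
  rewrite -big_mkcond /=; (case: eqP => E; last rewrite big_seq_cond).
- rewrite big_seq_cond [RHS]big_seq; apply: eq_bigl => q.
  by case: (boolP (q \in _)) => // /removals_area[_ ->]; rewrite E eqxx.
- by rewrite big_pred0 // => q; apply/negbTE/negP => /andP[/removals_area[_ ->] /eqP].
- rewrite big_seq_cond [RHS]big_seq; apply: eq_bigl => q.
  by case: (boolP (q \in _)) => // /splittings_area[_ ->]; rewrite E eqxx.
- by rewrite big_pred0 // => q; apply/negbTE/negP => /andP[/splittings_area[_ ->] /eqP].
Qed.

(** * Conjugation of diagrams *)

Definition swap (p : nat * nat) := (p.2, p.1).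

(** Reflection in the diagonal: the corners are met in the opposite order, with x and y
    exchanged. *)
Definition transpose (t : seq (nat * nat)) : seq (nat * nat) := rev (map swap t).

Lemma swapK : involutive swap. Proof. by case. Qed.

Lemma transposeK : involutive transpose.
Proof. by move=> t; rewrite /transpose map_rev revK (mapK swapK). Qed.

Lemma unzip1_transpose t : unzip1 (transpose t) = rev (unzip2 t).
Proof. by rewrite /unzip1 map_rev -map_comp. Qed.

Lemma unzip2_transpose t : unzip2 (transpose t) = rev (unzip1 t).
Proof. by rewrite /unzip2 map_rev -map_comp. Qed.

Lemma area_rcons t p : area (rcons t p) = (area t + (sumn (unzip1 t) + p.1) * p.2)%N.
Proof.
elim: t => [|z t IH] /=; first by lia.
rewrite IH /unzip2 map_rcons sumn_rcons; nia.
Qed.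

Lemma area_transpose t : area (transpose t) = area t.
Proof.
elim: t => //= p t IH.
by rewrite /transpose /= rev_cons area_rcons -/(transpose t) IH unzip1_transpose sumn_rev /=; nia.
Qed.

Lemma swap_cells K p : (swap p \in cells K) = (p \in cells K).
Proof. by rewrite !mem_cells andbC. Qed.

Lemma transpose_box K l t : (transpose t \in box K l) = (t \in box K l).
Proof.
rewrite !mem_box size_rev size_map all_rev all_map; congr (_ && _).
by apply: eq_all => p /=; rewrite swap_cells.
Qed.

Lemma perm_transpose_box K l : perm_eq (map transpose (box K l)) (box K l).
Proof.
apply: uniq_perm; rewrite ?map_inj_uniq ?uniq_box //; first exact: inv_inj transposeK.
by move=> t; rewrite -{1}(transposeK t) (mem_map (inv_inj transposeK)) transpose_box.
Qed.

Lemma sum_box_transpose (V : zmodType) n l (F : seq (nat * nat) -> V) :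
  \sum_(t <- box n l | area t == n) F (transpose t) =
  \sum_(t <- box n l | area t == n) F t.
Proof.
rewrite -[RHS](perm_big _ (perm_transpose_box n l)) /= big_map.
by apply: eq_bigl => t; rewrite area_transpose.
Qed.

Lemma perm_swap_cells K : perm_eq (map swap (cells K)) (cells K).
Proof.
apply: uniq_perm; rewrite ?map_inj_uniq ?uniq_cells //; first exact: inv_inj swapK.
by move=> t; rewrite -{1}(swapK t) (mem_map (inv_inj swapK)) swap_cells.
Qed.

(** Both sides sum [F] over all pairs of total area [n]. Conjugating rectangle and diagram permutes
    these pairs, so the rectangle may be inserted by width or by height. *)
Lemma sum_insertion_transpose (V : zmodType) n l
    (F : nat * nat -> seq (nat * nat) -> V) :
    \sum_(t <- box n l.+1 | area t == n) \sum_(q <- removals t) F q.1 q.2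
  + \sum_(t <- box n l | area t == n) \sum_(q <- splittings t) F q.1 q.2 =
    \sum_(t <- box n l.+1 | area t == n)
      \sum_(q <- removals t) F (swap q.1) (transpose q.2)
  + \sum_(t <- box n l | area t == n)
      \sum_(q <- splittings t) F (swap q.1) (transpose q.2).
Proof.
rewrite -[RHS](sum_insertion_area n l (fun p t => F (swap p) (transpose t))).
rewrite -sum_insertion_area -(perm_big _ (perm_swap_cells n)) /= big_map.
apply: eq_bigr => p _; rewrite -(perm_big _ (perm_transpose_box n l)) /= big_map.
by apply: eq_bigl => t; rewrite area_transpose mulnC.
Qed.

(** * Polynomial coefficients *)

Lemma removals_cons p t : removals (p :: t) =
  (p, widen p.1 t) :: map (prepend p) (removals t).
Proof. by []. Qed.

Lemma faulhaber k : exists P : nat -> {poly rat}, forall j, (j < k)%N ->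
  (size (P j) <= j.+2)%N /\
  forall y : nat, (P j).[y%:R] = \sum_(b < y) (b%:R : rat) ^+ j.
Proof.
elim: k => [|k [P hP]]; first by exists (fun=> 0).
(* The telescoping identity [tele] below, solved for the power sum of exponent [k]. *)
pose Q : {poly rat} :=
  k.+1%:R^-1 *: ('X^(k.+1) - \sum_(j < k) 'C(k.+1, j)%:R *: P j).
exists (fun j => if j == k then Q else P j) => j; rewrite ltnS leq_eqVlt.
case: eqP => [-> _|_ /=]; last exact: hP.
split=> [|y].
  rewrite (leq_trans (size_scale_leq _ _)) // (leq_trans (size_polyD _ _)) //.
  rewrite geq_max size_polyXn leqnn size_polyN /=.
  apply: (leq_trans (size_sum _ _ _)); apply/bigmax_leqP => i _.
  apply: leq_trans (size_scale_leq _ _) _.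
  by have [h _] := hP i (ltn_ord i); apply: leq_trans h _; rewrite !ltnS ltnW.
have tele : (y%:R : rat) ^+ k.+1 =
    \sum_(j < k.+1) 'C(k.+1, j)%:R * \sum_(b < y) b%:R ^+ j.
  elim: y => [|y IH].
    by rewrite expr0n big1 // => i _; rewrite big_ord0 mulr0.
  rewrite -nat1r exprDn big_ord_recr /= subnn expr0 mul1r binn mulr1n IH.
  rewrite -big_split; apply: eq_bigr => i _ /=.
  by rewrite expr1n mul1r big_ord_recr /= mulrDr addrC !mulr_natl.
rewrite /Q hornerZ hornerD hornerXn hornerN horner_sum tele big_ord_recr /=.
under [X in _ - X]eq_bigr => i _ do rewrite hornerZ (hP i (ltn_ord i)).2.
rewrite addrAC subrr add0r binSn mulrA mulVf ?mul1r //.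
by rewrite Num.Theory.pnatr_eq0.
Qed.

(** Expanding (y - b) ^ k reduces the sum to power sums of b; the factor b raises their exponents by
    one. *)
Lemma sum_power_convolution k : exists P : {poly rat}, (size P <= k.+3)%N /\
  forall y : nat,
    P.[y%:R] = \sum_(1 <= b < y) (b%:R : rat) * (y - b)%N%:R ^+ k.
Proof.
have [P hP] := faulhaber k.+2.
exists (\sum_(i < k.+1) ('C(k, i)%:R * (-1) ^+ i) *: ('X^(k - i) * P i.+1)).
split=> [|y].
  apply: (leq_trans (size_sum _ _ _)); apply/bigmax_leqP => i _.
  apply: leq_trans (size_scale_leq _ _) _.
  have [h _] := hP i.+1 (ltn_ord i).
  apply: leq_trans (size_polyMleq _ _) _; rewrite size_polyXn.
  by have := ltn_ord i; lia.
(* Starting at b = 0 changes nothing, because of the factor b. *)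
transitivity (\sum_(b < y) (b%:R : rat) * (y - b)%N%:R ^+ k); last first.
  rewrite -(big_mkord xpredT (fun b => (b%:R : rat) * (y - b)%N%:R ^+ k)).
  case: y => [|y]; first by rewrite !big_geq.
  by rewrite big_ltn // mul0r add0r.
rewrite horner_sum.
under [RHS]eq_bigr => b _ do
  rewrite (natrB _ (ltnW (ltn_ord b))) exprDn mulr_sumr.
rewrite exchange_big /=; apply: eq_bigr => i _.
rewrite hornerZ hornerM hornerXn (hP i.+1 (ltn_ord i)).2 !mulr_sumr.
apply: eq_bigr => b _; rewrite (exprNn b%:R) exprS -mulr_natr; ring.
Qed.

Definition mono (r v : seq nat) : rat :=
  \prod_(x <- zip r v) (x.2)%:R ^+ x.1.

Lemma mono_cons a r x v : mono (a :: r) (x :: v) = x%:R ^+ a * mono r v.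
Proof. by rewrite /mono big_cons. Qed.

Lemma mono_rev r v : size r = size v -> mono (rev r) (rev v) = mono r v.
Proof. by move=> E; rewrite /mono -rev_zip //; apply: perm_big; rewrite perm_rev. Qed.

Section PolyFun.
Variable pr : nat * nat -> nat.
Implicit Types f g : seq (nat * nat) -> rat.

(* [pr] is [fst] or [snd]: polynomials of degree at most [D] in one kind of
   coordinates, considered on diagrams with [l] corners only. *)
Inductive polyfun (l D : nat) : (seq (nat * nat) -> rat) -> Prop :=
| polyfun_mono r : size r = l -> (sumn r <= D)%N ->
    polyfun l D (fun t => mono r (map pr t))
| polyfun0 : polyfun l D (fun=> 0)
| polyfun_lin (c : rat) f g : polyfun l D f -> polyfun l D g ->
    polyfun l D (fun t => c * f t + g t)
| polyfun_ext f g : (forall t, size t = l -> f t = g t) ->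
    polyfun l D f -> polyfun l D g.

Lemma polyfunW l D E f : (D <= E)%N -> polyfun l D f -> polyfun l E f.
Proof.
move=> DE; elim=> {f} [r Hr Hs||c f g _ hf _ hg|f g E1 _ hf].
- by apply: polyfun_mono => //; apply: leq_trans DE.
- exact: polyfun0.
- exact: polyfun_lin.
- exact: polyfun_ext hf.
Qed.

Lemma polyfunD l D f g : polyfun l D f -> polyfun l D g ->
  polyfun l D (fun t => f t + g t).
Proof.
move=> hf hg; apply: polyfun_ext (polyfun_lin 1 hf hg) => t _.
by rewrite mul1r.
Qed.

Lemma polyfun_lincomb l D n (c : 'I_n -> rat) (F : 'I_n -> seq (nat * nat) -> rat) :
  (forall i, polyfun l D (F i)) ->
  polyfun l D (fun t => \sum_(i < n) c i * F i t).
Proof.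
elim: n c F => [|n IH] c F hF.
  by apply: polyfun_ext (polyfun0 l D) => t _; rewrite big_ord0.
apply: polyfun_ext (polyfun_lin (c ord0) (hF ord0)
  (IH (fun i => c (lift ord0 i)) (fun i => F (lift ord0 i)) _)) => [t _|i].
  by rewrite big_ord_recl.
exact: hF.
Qed.

Lemma polyfun_cons e l D f : polyfun l D f ->
  polyfun l.+1 (e + D)
    (fun t => (pr (head (0, 0)%N t))%:R ^+ e * f (behead t)).
Proof.
elim=> {f} [r Hr Hs||c f g _ hf _ hg|f g E1 _ hf].
- have h : polyfun l.+1 (e + D) (fun t => mono (e :: r) (map pr t)).
    by apply: polyfun_mono => /=; rewrite ?Hr ?leq_add2l.
  apply: polyfun_ext h => -[|p t] //= _.
  by rewrite mono_cons.
- by apply: polyfun_ext (polyfun0 _ _) => t _; rewrite mulr0.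
- by apply: polyfun_ext (polyfun_lin c hf hg) => t _; ring.
- by apply: polyfun_ext hf => -[|p t] //= [] /E1 ->.
Qed.

End PolyFun.

(** Conjugation turns the y-coordinates into x-coordinates in reverse order, so the exponents are
    reversed too. *)
Lemma polyfun_transpose l D f :
  polyfun snd l D f -> polyfun fst l D (fun t => f (transpose t)).
Proof.
elim=> {f} [r Hr Hs||c f g _ hf _ hg|f g E1 _ hf].
- have h : polyfun fst l D (fun t => mono (rev r) (map fst t)).
    by apply: polyfun_mono; rewrite ?size_rev ?sumn_rev.
  apply: polyfun_ext h => t Ht.
  by rewrite -/(unzip2 _) unzip2_transpose -mono_rev ?size_rev ?size_map ?Ht // revK.
- exact: polyfun0.
- exact: polyfun_lin.
- by apply: polyfun_ext hf => t Ht; apply: E1; rewrite size_rev size_map.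
Qed.

(** The exponent [e] is general because [prepend] adds the head width to the rectangle width: the
    binomial expansion calls the induction hypothesis for all exponents up to [e]. *)
Lemma polyfun_removals1 r e :
  polyfun fst (size r).+1 (e + sumn r)
    (fun t => \sum_(q <- removals t) (q.1.1)%:R ^+ e * mono r (unzip1 q.2)).
Proof.
elim: r e => [|k r IH] e.
  have h : polyfun fst 1 (e + 0) (fun t => mono [:: e] (map fst t)).
    by apply: polyfun_mono.
  apply: polyfun_ext h => -[|p [|z t]] //= _.
  by rewrite big_seq1 !mono_cons.
(* Removal of the head corner: the next corner is widened, and the [k]-th power of its new width is
   expanded. *)
have h1 : polyfun fst (size r).+2 (e + (k + sumn r)) (fun t =>
    \sum_(i < k.+1) 'C(k, i)%:R *
      ((head (0, 0)%N t).1%:R ^+ (e + (k - i))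
         * mono ((i : nat) :: r) (map fst (behead t)))).
  apply: polyfun_lincomb => i.
  have hi : polyfun fst (size r).+1 (i + sumn r)
      (fun t => mono ((i : nat) :: r) (map fst t)) by apply: polyfun_mono.
  apply: polyfunW (polyfun_cons (e + (k - i)) hi).
  by have := ltn_ord i; lia.
(* Removal of a later corner: the power of the shifted rectangle width is expanded. *)
have h2 : polyfun fst (size r).+2 (e + (k + sumn r)) (fun t =>
    \sum_(i < e.+1) 'C(e, i)%:R *
      ((head (0, 0)%N t).1%:R ^+ (e - i + k) *
        \sum_(q <- removals (behead t)) (q.1.1)%:R ^+ i * mono r (unzip1 q.2))).
  apply: polyfun_lincomb => i; apply: polyfunW (polyfun_cons (e - i + k) (IH i)).
  by have := ltn_ord i; lia.
apply: polyfun_ext (polyfunD h1 h2) => -[|p [|z t]] // _.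
rewrite (removals_cons p) [RHS]big_cons [X in _ = _ + X]big_map; congr (_ + _).
  rewrite /= !mono_cons natrD exprDn mulr_suml mulr_sumr.
  by apply: eq_bigr => i _; rewrite !mono_cons exprD -mulr_natl; ring.
rewrite [behead _]/= [head _ _]/=.
under [LHS]eq_bigr => i _ do rewrite !mulr_sumr.
rewrite exchange_big /=; apply: eq_bigr => q _.
rewrite mono_cons natrD exprDn mulr_suml.
by apply: eq_bigr => i _; rewrite exprD -mulr_natl; ring.
Qed.

(** Heights are not merged by a removal, so the removed corner just contributes its own y-coordinate
    to the first power. *)
Lemma polyfun_removals2 r :
  polyfun snd (size r).+1 (1 + sumn r)
    (fun t => \sum_(q <- removals t) (q.1.2)%:R * mono r (unzip2 q.2)).
Proof.
elim: r => [|k r IH].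
  have h : polyfun snd 1 (1 + 0) (fun t => mono [:: 1%N] (map snd t)).
    by apply: polyfun_mono.
  apply: polyfun_ext h => -[|p [|z t]] //= _.
  by rewrite big_seq1 !mono_cons.
have h1 : polyfun snd (size r).+2 (1 + (k + sumn r))
    (fun t => mono [:: 1%N, k & r] (map snd t)) by apply: polyfun_mono.
have h2 := polyfun_cons k IH.
rewrite addnCA in h2.
apply: polyfun_ext (polyfunD h1 h2) => -[|p [|z t]] // _.
rewrite (removals_cons p) [RHS]big_cons [X in _ = _ + X]big_map; congr (_ + _).
  by rewrite /= !mono_cons.
rewrite mulr_sumr; apply: eq_bigr => q _ /=.
by rewrite mono_cons mulrCA.
Qed.

(** Splitting a corner of height y gives the sum of b * (y - b) ^ k over 1 <= b < y, of degree at
    most k + 2 in y; the other heights stay as they are. *)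
Lemma polyfun_splittings2 r :
  polyfun snd (size r) (2 + sumn r)
    (fun t => \sum_(q <- splittings t) (q.1.2)%:R * mono r (unzip2 q.2)).
Proof.
elim: r => [|k r IH].
  apply: polyfun_ext (polyfun0 _ _ _) => -[|p t] // _.
  by rewrite big_nil.
have [P [sP hP]] := sum_power_convolution k.
have h1 : polyfun snd (size r).+1 (2 + (k + sumn r)) (fun t =>
    \sum_(i < size P) P`_i * mono ((i : nat) :: r) (map snd t)).
  apply: polyfun_lincomb => i; apply: polyfun_mono => //=.
  by rewrite addnA leq_add2r; exact: leq_trans (ltn_ord i) sP.
have h2 := polyfun_cons k IH.
rewrite addnCA in h2.
apply: polyfun_ext (polyfunD h1 h2) => -[|p t] // _.
rewrite [splittings (p :: _)]/= big_cat !big_map; congr (_ + _).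
  transitivity (P.[p.2%:R] * mono r (unzip2 t)).
    rewrite horner_coef mulr_suml; apply: eq_bigr => i _ /=.
    by rewrite mono_cons mulrA.
  rewrite hP mulr_suml; apply: eq_bigr => b _ /=.
  by rewrite mono_cons mulrA.
rewrite mulr_sumr; apply: eq_bigr => q _ /=.
by rewrite mono_cons mulrCA.
Qed.

(** This is [w_1 + ... + w_l] with [w_j = v_1 + ... + v_j]: the head entry occurs in every [w_j]. *)
Fixpoint prefix_sums (v : seq nat) : nat :=
  if v is x :: v' then (x * (size v').+1 + prefix_sums v')%N else 0%N.

Lemma polyfun_prefix_sums r :
  polyfun fst (size r) (1 + sumn r)
    (fun t => (prefix_sums (unzip1 t))%:R * mono r (unzip1 t)).
Proof.
elim: r => [|k r IH].
  apply: polyfun_ext (polyfun0 _ _ _) => -[|p t] // _.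
  by rewrite mul0r.
have h1 : polyfun fst (size r).+1 (1 + (k + sumn r))
    (fun t => mono (k.+1 :: r) (map fst t)) by apply: polyfun_mono.
have h2 := polyfun_cons k IH.
rewrite addnCA in h2.
apply: polyfun_ext (polyfun_lin (size r).+1%:R h1 h2) => -[|p t] //= [E].
by rewrite !mono_cons size_map E natrD natrM exprS; ring.
Qed.

Lemma size_removals t q : q \in removals t -> size t = (size q.2).+1.
Proof.
elim: t q => [|p t IH] q //=.
rewrite inE => /orP[/eqP->|/mapP[q' /IH E ->]]; first by case: t {IH}.
by rewrite E.
Qed.

Lemma size_splittings t : all pos_cell t ->
  (size (splittings t) + size t)%N = sumn (unzip2 t).
Proof.
elim: t => [|p t IH] //= /andP[/andP[_ p2] /IH <-].
by rewrite size_cat !size_map size_iota; lia.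
Qed.

(** The width [w_j] occurs [y_j - 1] times among the splittings, and the area is the sum of all
    [w_j * y_j]. *)
Lemma sum_splittings t : all pos_cell t ->
  (\sum_(q <- splittings t) q.1.1 + prefix_sums (unzip1 t))%N = area t.
Proof.
elim: t => [|p t IH] /=; first by rewrite big_nil.
move=> /andP[/andP[_ p2] ht]; rewrite -(IH ht) -(size_splittings ht).
(* The head width occurs once for each of its own splittings and once more for every splitting of
   the tail, whence the use of [size_splittings]. *)
rewrite big_cat !big_map /= big_const_seq count_predT size_iota.
rewrite big_split /= big_const_seq count_predT size_map !iter_addn_0.
by move: p2; move: (\sum_(i <- _) _)%N => S; nia.
Qed.

Definition boxsum l n (f : seq (nat * nat) -> rat) : rat :=
  \sum_(t <- box n l | area t == n) f t.

(** The two insertion counts are compared for the weight a * mono r x. The splittings by width yield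
    the eigenvalue [n] minus [prefix_sums]; solving for it gives the formula. *)
Lemma boxsum_derivation n r :
  n%:R * boxsum (size r) n (fun t => mono r (unzip1 t)) =
    boxsum (size r).+1 n (fun t =>
      \sum_(q <- removals (transpose t)) (q.1.2)%:R * mono (rev r) (unzip2 q.2))
  + boxsum (size r) n (fun t =>
      \sum_(q <- splittings (transpose t)) (q.1.2)%:R * mono (rev r) (unzip2 q.2))
  - boxsum (size r).+1 n (fun t =>
      \sum_(q <- removals t) (q.1.1)%:R ^+ 1 * mono r (unzip1 q.2))
  + boxsum (size r) n (fun t =>
      (prefix_sums (unzip1 t))%:R * mono r (unzip1 t)).
Proof.
rewrite /boxsum; set l := size r.
pose F (p : nat * nat) (t : seq (nat * nat)) := (p.1)%:R * mono r (unzip1 t).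
have swapE q : size q.2 = l ->
    F (swap q.1) (transpose q.2) = (q.1.2)%:R * mono (rev r) (unzip2 q.2).
  by move=> E; rewrite /F unzip1_transpose -{1}(revK r) mono_rev ?size_rev ?size_map ?E.
have EA : \sum_(t <- box n l.+1 | area t == n)
      \sum_(q <- removals t) F (swap q.1) (transpose q.2) =
    \sum_(t <- box n l.+1 | area t == n)
      \sum_(q <- removals t) (q.1.2)%:R * mono (rev r) (unzip2 q.2).
  rewrite big_seq_cond [RHS]big_seq_cond; apply: eq_bigr => t /andP[/mem_box_pos[st _] _].
  rewrite big_seq [RHS]big_seq; apply: eq_bigr => q /size_removals E.
  by apply: swapE; apply/eqP; rewrite -eqSS -E st.
have EB : \sum_(t <- box n l | area t == n)
      \sum_(q <- splittings t) F (swap q.1) (transpose q.2) =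
    \sum_(t <- box n l | area t == n)
      \sum_(q <- splittings t) (q.1.2)%:R * mono (rev r) (unzip2 q.2).
  rewrite big_seq_cond [RHS]big_seq_cond; apply: eq_bigr => t /andP[/mem_box_pos[st _] _].
  rewrite big_seq [RHS]big_seq; apply: eq_bigr => q /unzip1_splittings E.
  by apply: swapE; rewrite -(size_map fst) -/(unzip1 _) E size_map.
(* Splitting leaves the x-coordinates alone, so the monomial factors out and [sum_splittings]
   evaluates the sum of the widths. *)
have EC : \sum_(t <- box n l | area t == n) \sum_(q <- splittings t) F q.1 q.2 =
    n%:R * (\sum_(t <- box n l | area t == n) mono r (unzip1 t))
    - \sum_(t <- box n l | area t == n)
        (prefix_sums (unzip1 t))%:R * mono r (unzip1 t).
  rewrite mulr_sumr -sumrB.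
  rewrite big_seq_cond [RHS]big_seq_cond; apply: eq_bigr => t.
  move=> /andP[/mem_box_pos[_ ht] /eqP <-].
  rewrite -mulrBl -(sum_splittings ht) natrD addrK natr_sum mulr_suml.
  by rewrite big_seq [RHS]big_seq; apply: eq_bigr => q /unzip1_splittings; rewrite /F => ->.
have ED : \sum_(t <- box n l.+1 | area t == n)
      \sum_(q <- removals t) (q.1.1)%:R ^+ 1 * mono r (unzip1 q.2) =
    \sum_(t <- box n l.+1 | area t == n) \sum_(q <- removals t) F q.1 q.2 by [].
have := sum_insertion_transpose n l F; rewrite ED EA EB EC.
(* Conjugating the summation variable turns polynomials in y into polynomials in x, the form that
   brackets require. *)
rewrite -(sum_box_transpose n l.+1 (fun t =>
    \sum_(q <- removals t) (q.1.2)%:R * mono (rev r) (unzip2 q.2))).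
rewrite -(sum_box_transpose n l (fun t =>
    \sum_(q <- splittings t) (q.1.2)%:R * mono (rev r) (unzip2 q.2))).
move=> <-; ring.
Qed.

(** * Brackets as sums over diagrams *)

Fixpoint suffix_sums (v : seq nat) : seq nat :=
  if v is x :: v' then (x + sumn v')%N :: suffix_sums v' else [::].

(** Recovers [y_i = u_i - u_(i+1)]; the default 0 of [head] plays the part of [u_(l+1)]. *)
Fixpoint differences (v : seq nat) : seq nat :=
  if v is x :: v' then (x - head 0 v')%N :: differences v' else [::].

Lemma size_suffix_sums v : size (suffix_sums v) = size v.
Proof. by elim: v => //= x v ->. Qed.

Lemma size_differences v : size (differences v) = size v.
Proof. by elim: v => //= x v ->. Qed.

Lemma suffix_sumsK : cancel suffix_sums differences.
Proof. by elim=> [|x [|y v] IH] //=; rewrite ?addn0 ?subn0 // addnK -[in RHS]IH. Qed.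

Lemma differencesK v : sorted gtn v -> suffix_sums (differences v) = v.
Proof.
(* The differences telescope to the first entry; the induction needs this for the tail. *)
move=> h; suff: suffix_sums (differences v) = v /\
  sumn (differences v) = head 0%N v by case.
elim: v h => [|x [|y v] IH] //=; first by rewrite subn0 addn0.
by case/andP=> yx /IH /= [-> ->]; rewrite subnK // ltnW.
Qed.

Lemma suffix_sums_decreasing v : all (leq 1) v ->
  sorted gtn (suffix_sums v) && all (leq 1) (suffix_sums v).
Proof.
elim: v => [|x [|y v] IH] //=; first by rewrite addn0 !andbT.
move=> /andP[x1 /IH /= /andP[-> /andP[h ->]]].
by rewrite h !andbT /=; apply/andP; split; lia.
Qed.

Lemma all_differences n v : sorted gtn v -> all (leq 1) v ->
  all (geq n) v -> all (fun x => 1 <= x <= n)%N (differences v).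
Proof.
elim: v => [|x [|y v] IH] //=; first by rewrite subn0 !andbT => _ -> ->.
move=> /andP[yx h] /andP[x1 hp] /andP[xn hn].
by rewrite [X in _ && X](IH h hp hn) andbT; lia.
Qed.

Lemma area_suffix_sums t : area t =
  (\sum_(x <- zip (suffix_sums (unzip2 t)) (unzip1 t)) x.1 * x.2)%N.
Proof. by elim: t => [|p t IH] /=; rewrite ?big_nil // big_cons IH mulnC. Qed.

Section Sigma.
Variables (l n : nat).
Implicit Types (f g : {ffun 'I_l -> 'I_n.+1}).

Definition values f : seq nat := [seq (f i : nat) | i <- enum 'I_l].

Lemma size_values f : size (values f) = l.
Proof. by rewrite size_map size_enum_ord. Qed.

Lemma nth_values f (i : 'I_l) : nth 0%N (values f) i = f i.
Proof. by rewrite (nth_map i) ?size_enum_ord // nth_ord_enum. Qed.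

Lemma values_inj : injective values.
Proof.
by move=> f g E; apply/ffunP => i; apply: val_inj; rewrite /= -!nth_values E.
Qed.

Lemma values_onto v : size v = l -> all (geq n) v -> exists f, values f = v.
Proof.
move=> sv /allP vn; exists [ffun i : 'I_l => inord (nth 0%N v i)].
apply: (@eq_from_nth _ 0%N) => [|i]; rewrite size_values ?sv // => il.
rewrite (nth_values _ (Ordinal il)) ffunE inordK // ltnS.
by apply: vn; rewrite mem_nth ?sv.
Qed.

Lemma all_values (P : pred nat) f :
  [forall i, P (f i)] = all P (values f).
Proof.
rewrite all_map; apply/forallP/allP => [h i _|h i]; first exact: h.
by apply: h; rewrite mem_enum.
Qed.

Lemma values_le f : all (geq n) (values f).
Proof. by rewrite -all_values; apply/forallP => i; rewrite /= -ltnS. Qed.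

Lemma sorted_values f :
  [forall i : 'I_l, forall j : 'I_l, (i < j) ==> (f j < f i)]%N =
  sorted gtn (values f).
Proof.
have tr : transitive gtn by move=> a b c /= h1 h2; apply: ltn_trans h2 h1.
rewrite sorted_pairwise //; apply/idP/(pairwiseP 0%N) => [h i j|h].
  rewrite !inE size_values => il jl ij.
  move/forallP/(_ (Ordinal il))/forallP/(_ (Ordinal jl))/implyP/(_ ij): h.
  by rewrite -!nth_values.
apply/forallP => i; apply/forallP => j; apply/implyP => ij.
by have := h i j; rewrite !inE size_values !nth_values /=; apply.
Qed.

Lemma sum_values f g : (\sum_(i < l) f i * g i =
  \sum_(x <- zip (values f) (values g)) x.1 * x.2)%N.
Proof.
rewrite (big_nth (0, 0)%N) size_zip !size_values minnn big_mkord.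
by apply: eq_bigr => i _; rewrite nth_zip ?size_values //= !nth_values.
Qed.

Lemma mono_values r f : size r = l ->
  mono r (values f) = (\prod_(i < l) f i ^ nth 0 r i)%N%:R.
Proof.
move=> sr; rewrite /mono (big_nth (0, 0)%N) size_zip size_values sr minnn.
rewrite big_mkord natr_prod; apply: eq_bigr => i _.
by rewrite nth_zip ?size_values //= nth_values natrX.
Qed.

End Sigma.

(** The map [phi] takes (u, v) to the diagram with widths [v_i] and heights [u_i - u_(i+1)]; suffix
    sums of the heights invert it. *)
Lemma sigma_boxsum r n :
  (sigma r n)%:R = boxsum (size r) n (fun t => mono r (unzip1 t)).
Proof.
rewrite /sigma /boxsum natr_sum; set l := size r.
pose T := {ffun 'I_l -> 'I_n.+1}.
pose P (uv : T * T) := [&& all (leq 1) (values uv.1), sorted gtn (values uv.1),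
  all (leq 1) (values uv.2) &
  (\sum_(x <- zip (values uv.1) (values uv.2)) x.1 * x.2 == n)%N].
pose phi (uv : T * T) := zip (values uv.2) (differences (values uv.1)).
have phi1 uv : unzip1 (phi uv) = values uv.2.
  by rewrite unzip1_zip // size_differences !size_values.
have phi2 uv : unzip2 (phi uv) = differences (values uv.1).
  by rewrite unzip2_zip // size_differences !size_values.
transitivity (\sum_(uv : T * T | P uv) mono r (unzip1 (phi uv))).
  apply: eq_big => [uv|uv _]; last by rewrite phi1 mono_values.
  by rewrite /P -!all_values -sorted_values -sum_values.
rewrite -big_filter -[RHS]big_filter -(big_map phi xpredT (fun t => mono r (unzip1 t))).
apply: perm_big; apply: uniq_perm.
- rewrite map_inj_in_uniq ?filter_uniq ?index_enum_uniq // => uv uv'.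
  rewrite !mem_filter => /andP[/and4P[_ h _ _] _] /andP[/and4P[_ h' _ _] _] E.
  have E1 : uv.1 = uv'.1.
    by apply: values_inj; rewrite -(differencesK h) -(differencesK h') -!phi2 E.
  have E2 : uv.2 = uv'.2 by apply: values_inj; rewrite -!phi1 E.
  by case: uv uv' E1 E2 {h h' E} => [u v] [u' v'] /= -> ->.
- by rewrite filter_uniq ?uniq_box.
move=> t; rewrite mem_filter; apply/mapP/andP => [[uv]|[/eqP at_n bt]].
  rewrite mem_filter => /andP[/and4P[u1 us v1 /eqP En] _] ->.
  rewrite area_suffix_sums phi1 phi2 differencesK // En; split=> //.
  rewrite mem_box size_zip size_differences !size_values minnn eqxx /=.
  apply/allP => -[x y] /[dup].
  move=> /(map_f fst); rewrite -/(unzip1 _) phi1 /= => hx.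
  move=> /(map_f snd); rewrite -/(unzip2 _) phi2 /= => hy.
  have /= xn := allP (values_le uv.2) _ hx.
  rewrite mem_cells /= (allP v1 _ hx) xn /=.
  exact: (allP (all_differences us u1 (values_le _)) _ hy).
have [st pt] := mem_box_pos bt.
have t1 : all (leq 1) (unzip1 t).
  by rewrite all_map; apply: sub_all pt => p /andP[].
have t2 : all (leq 1) (unzip2 t).
  by rewrite all_map; apply: sub_all pt => p /andP[].
have /andP[us u1] := suffix_sums_decreasing t2.
have [v Ev] : exists v : T, values v = unzip1 t.
  apply: values_onto; rewrite ?size_map //; apply/allP => _ /mapP[p hp ->].
  by move: bt; rewrite mem_box => /andP[_ /allP/(_ _ hp)] /=;
     rewrite mem_cells => /andP[/andP[]].
have [u Eu] : exists u : T, values u = suffix_sums (unzip2 t).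
  apply: values_onto; rewrite ?size_suffix_sums ?size_map //.
  (* Every [u_i] is at most the sum of all heights, which the area [n] bounds. *)
  have [_] := area_ge pt; rewrite at_n; elim: (unzip2 t) => //= x s IH h.
  by rewrite h IH //; apply: leq_trans h; apply: leq_addl.
exists (u, v); last by rewrite /phi /= Ev Eu suffix_sumsK zip_unzip.
by rewrite mem_filter mem_index_enum andbT /P /= Eu Ev -area_suffix_sums at_n
  eqxx u1 us t1.
Qed.

(** * Spans of brackets *)

Section Span.
Variables (K : nzRingType) (V : lmodType K).
Implicit Types S : V -> Prop.

Lemma linear_span0 S : linear_span S 0.
Proof. by exists 0%N, (fun=> 0), (fun=> 0); split=> [[]|] //; rewrite big_ord0. Qed.

Lemma linear_span_cons S a v w :
  S v -> linear_span S w -> linear_span S (a *: v + w).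
Proof.
move=> Sv [n [c [x [Sx ->]]]].
exists n.+1, (fun i => oapp c a (unlift ord0 i)),
  (fun i => oapp x v (unlift ord0 i)); split=> [i|].
  by case: unliftP => [j|] _ /=.
rewrite big_ord_recl unlift_none /=; congr (_ + _).
by apply: eq_bigr => i _; rewrite liftK.
Qed.

Lemma linear_span_ind S (P : V -> Prop) : P 0 ->
  (forall a v w, S v -> P w -> P (a *: v + w)) ->
  forall x, linear_span S x -> P x.
Proof.
move=> P0 PS x [n [c [v [Sv ->]]]].
elim: n c v Sv => [|n IH] c v Sv; first by rewrite big_ord0.
by rewrite big_ord_recl; apply: PS => //; apply: IH.
Qed.

Lemma linear_span_lin S a v w :
  linear_span S v -> linear_span S w -> linear_span S (a *: v + w).
Proof.
move=> + hw; move: v; apply: linear_span_ind => [|b v v' Sv IH].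
  by rewrite scaler0 add0r.
by rewrite scalerDr scalerA -addrA; apply: linear_span_cons.
Qed.

Lemma linear_spanS S S' v : (forall x, S x -> S' x) ->
  linear_span S v -> linear_span S' v.
Proof. by move=> h [n [c [x [Sx ->]]]]; exists n, c, x; split=> // i; apply: h. Qed.

End Span.

Lemma FilWLS k l k' l' f : (k <= k')%N -> (l <= l')%N ->
  FilWL k l f -> FilWL k' l' f.
Proof.
move=> hk hl; apply: linear_spanS => x [s [s1 sk sl ->]].
by exists s; split=> //; [apply: leq_trans hk | apply: leq_trans hl].
Qed.

Lemma FilWL_MD k l f : FilWL k l f -> MD f.
Proof. by apply: linear_spanS => x [s [s1 _ _ ->]]; exists s. Qed.

(** The constant term is set to 0 as in [bracket]; this matters for [l = 0], where the empty diagram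
    has area 0. *)
Definition boxseries l (f : seq (nat * nat) -> rat) : fps rat :=
  Fps (fun n => if n == 0%N then 0 else boxsum l n f).

Lemma boxseries_lin l a f g : boxseries l (fun t => a * f t + g t) =
  a *: boxseries l f + boxseries l g.
Proof.
apply: fpsP => n /=; case: eqP => _; first by rewrite mulr0 addr0.
by rewrite /boxsum big_split mulr_sumr.
Qed.

Lemma bracket_boxseries s : s != [::] -> bracket s =
  ((\prod_(k <- s) (k.-1)`!)%N%:R)^-1 *:
    boxseries (size s) (fun t => mono (map predn s) (unzip1 t)).
Proof.
case: s => // k s _; congr (_ *: _); apply: fpsP => n /=.
by rewrite sigma_boxsum /= size_map.
Qed.

(** A monomial with exponents [r_i] is a multiple of the bracket with entries [r_i + 1], hence the
    weight bound [D + l]. *)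
Lemma FilWL_boxseries l D f :
  polyfun fst l D f -> FilWL (D + l) l (boxseries l f).
Proof.
elim=> {f} [r sr rD||c f g _ hf _ hg|f g E _].
- have [l0|l0] := eqVneq l 0%N.
    suff -> : boxseries l (fun t => mono r (map fst t)) = 0 by apply: linear_span0.
    apply: fpsP => n /=; case: eqP => // n0.
    by rewrite /boxsum l0 big_cons big_nil /= eq_sym; case: eqP n0.
  pose s := map succn r.
  have s0 : s != [::] by rewrite -size_eq0 size_map sr.
  pose c : rat := (\prod_(k <- s) (k.-1)`!)%N%:R.
  have c0 : c != 0.
    by rewrite Num.Theory.pnatr_eq0 -lt0n prodn_gt0 // => i; rewrite fact_gt0.
  have -> : boxseries l (fun t => mono r (map fst t)) = c *: bracket s.
    rewrite bracket_boxseries // scalerA divff // scale1r /s size_map sr.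
    by rewrite -map_comp map_id.
  rewrite -[_ *: _]addr0; apply: linear_span_cons; last exact: linear_span0.
  exists s; split=> //; rewrite /s ?size_map ?sr //.
    by rewrite all_map; apply/allP.
  rewrite /weight /s -sr; apply: leq_trans (leq_add rD (leqnn _)).
  by elim: (r) => //= k v IH; lia.
- suff -> : boxseries l (fun=> 0) = 0 by apply: linear_span0.
  by apply: fpsP => n /=; case: eqP => // _; rewrite /boxsum big1.
- by rewrite boxseries_lin; apply: linear_span_lin.
- suff -> : boxseries l f = boxseries l g by [].
  apply: fpsP => n /=; case: eqP => // _; rewrite /boxsum big_seq_cond.
  rewrite [RHS]big_seq_cond; apply: eq_bigr => t /andP[/mem_box_pos[st _] _].
  exact: E.
Qed.

(** * The operator q d/dq on brackets *)

Lemma qderiv_lin a (f g : fps rat) :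
  qderiv (a *: f + g) = a *: qderiv f + qderiv g.
Proof.
apply: fpsP => n; transitivity (a * qderiv f n + qderiv g n); last by [].
by rewrite !qderivE mulrnDl mulrnAr.
Qed.

Lemma qderivM (f g : fps rat) : qderiv (f * g) = qderiv f * g + f * qderiv g.
Proof.
apply: fpsP => n; transitivity (\sum_(i < n.+1) qderiv f i * g (n - i)%N
  + \sum_(i < n.+1) f i * qderiv g (n - i)%N); last by [].
rewrite qderivE -sumrMnl -big_split.
apply: eq_bigr => i _; rewrite !qderivE mulrnAl mulrnAr /= -mulrnDr subnKC //.
by rewrite -ltnS.
Qed.

Lemma qderiv0 : qderiv (0 : fps rat) = 0.
Proof. by apply: fpsP => n; rewrite qderivE mul0rn. Qed.

Lemma FilWL_qderiv_boxseries r :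
  FilWL (sumn r + size r + 2) (size r + 1)
    (qderiv (boxseries (size r) (fun t => mono r (unzip1 t)))).
Proof.
set l := size r.
pose G1 t := \sum_(q <- removals (transpose t)) (q.1.2)%:R * mono (rev r) (unzip2 q.2).
pose G2 t := \sum_(q <- splittings (transpose t)) (q.1.2)%:R * mono (rev r) (unzip2 q.2).
pose G3 t := \sum_(q <- removals t) (q.1.1)%:R ^+ 1 * mono r (unzip1 q.2).
pose G4 (t : seq (nat * nat)) := (prefix_sums (unzip1 t))%:R * mono r (unzip1 t).
have -> : qderiv (boxseries l (fun t => mono r (unzip1 t))) =
    1 *: boxseries l.+1 G1 + (1 *: boxseries l G2 +
      ((-1) *: boxseries l.+1 G3 + boxseries l G4)).
  apply: fpsP => n; rewrite qderivE /=; case: eqP => [->|_]; first by rewrite !mulr0 !addr0.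
  by rewrite -mulr_natl boxsum_derivation -/l !mul1r mulN1r !addrA.
have h1 := polyfun_transpose (polyfun_removals2 (rev r)).
have h2 := polyfun_transpose (polyfun_splittings2 (rev r)).
rewrite size_rev sumn_rev -/l in h1 h2.
have h3 := polyfun_removals1 r 1.
have h4 := polyfun_prefix_sums r.
have W f k m : FilWL k m f -> (k <= sumn r + l + 2)%N -> (m <= l + 1)%N ->
  FilWL (sumn r + l + 2) (l + 1) f by move=> h ? ?; apply: FilWLS h.
(* The weight bounds are [sumn r + l + 2] for the first three terms and [sumn r + l + 1] for the
   last; only the two removal terms have length [l + 1]. *)
apply: linear_span_lin; [|apply: linear_span_lin; [|apply: linear_span_lin]].
- by apply: W (FilWL_boxseries h1) _ _; lia.
- by apply: W (FilWL_boxseries h2) _ _; lia.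
- by apply: W (FilWL_boxseries h3) _ _; lia.
- by apply: W (FilWL_boxseries h4) _ _; lia.
Qed.

Lemma FilWL_qderiv_bracket s : all (leq 1) s ->
  FilWL (weight s + 2) (size s + 1) (qderiv (bracket s)).
Proof.
have [->|s0 s1] := eqVneq s [::].
  suff -> : qderiv (bracket [::]) = 0 by move=> _; apply: linear_span0.
  by apply: fpsP => n; rewrite qderivE /=; case: n => [|n]; rewrite ?mulr0n ?mul0rn.
rewrite bracket_boxseries // -[_ *: boxseries _ _]addr0 qderiv_lin qderiv0.
apply: linear_span_lin; last exact: linear_span0.
have := FilWL_qderiv_boxseries (map predn s); rewrite size_map.
suff -> : (sumn (map predn s) + size s)%N = weight s by [].
by elim: s s1 {s0} => //= k s IH /andP[k1 /IH <-]; lia.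
Qed.

Lemma FilWL_qderiv k l f : FilWL k l f -> FilWL (k + 2) (l + 1) (qderiv f).
Proof.
move: f; apply: linear_span_ind => [|a v w [s [s1 sk sl ->]] hw].
  by rewrite qderiv0; apply: linear_span0.
rewrite qderiv_lin; apply: linear_span_lin hw.
by apply: FilWLS (FilWL_qderiv_bracket s1); rewrite leq_add2r.
Qed.

Lemma MD_qderiv f : MD f -> MD (qderiv f).
Proof.
move: f; apply: linear_span_ind => [|a v w [s [s1 ->]] hw].
  by rewrite qderiv0; apply: linear_span0.
rewrite qderiv_lin; apply: linear_span_lin hw.
exact: FilWL_MD (FilWL_qderiv_bracket s1).
Qed.

Theorem mainTheorem2 :
  [/\ forall f : fps rat, MD f -> MD (qderiv f),
      derivation_of MD (@qderiv rat)
    & forall (k l : nat) (f : fps rat),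
        FilWL k l f -> FilWL (k + 2) (l + 1) (qderiv f)].
Proof.
split; [exact: MD_qderiv | split | exact: FilWL_qderiv].
- exact: MD_qderiv.
- by move=> a f g _ _; apply: qderiv_lin.
- by move=> f g _ _; apply: qderivM.
Qed.
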